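(* Let $\mathfrak{A}$ be a $C^*$-algebra, let $T$ be a locally compact Hausdorff space equipped with a Radon measure $\mu$, and let $(A_t)_{t\in T}$ and $(B_t)_{t\in T}$ be continuous fields of operators in $\mathfrak{A}$ such that the functions $t\mapsto A_t$ and $t\mapsto B_t$ are norm continuous on $T$ and the functions $t\mapsto\|A_t\|$ and $t\mapsto\|B_t\|$ are integrable. Let $\alpha:T\times T\to\mathbb{C}$ be a measurable function such that $\overline{\alpha(t,s)}\,\alpha(s,t)=1$ for all $t,s\in T$. Then $$\int_T\int_T\left|\alpha(t,s)A_t-\alpha(s,t)A_s\right|^2d\mu(t)d\mu(s)+\int_T\int_T\left|\alpha(t,s)B_t-\alpha(s,t)B_s\right|^2d\mu(t)d\mu(s)$$ $$=2\int_T\int_T\left|\alpha(t,s)A_t-\alpha(s,t)B_s\right|^2d\mu(t)d\mu(s)-2\left|\int_T(A_t-B_t)\,d\mu(t)\right|^2.$$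
   Context: For an element $X$ of a $C^*$-algebra, $|X|=(X^*X)^{1/2}$, so $|X|^2=X^*X$. A field $(A_t)_{t\in T}$ of operators in $\mathfrak{A}$ is called continuous if $t\mapsto A_t$ is norm continuous on $T$. If moreover $t\mapsto\|A_t\|$ is integrable with respect to $\mu$, then $\int_T A_t\,d\mu(t)$ denotes the Bochner integral, i.e. the unique element of $\mathfrak{A}$ with $\varphi\left(\int_T A_t\,d\mu(t)\right)=\int_T\varphi(A_t)\,d\mu(t)$ for every $\varphi$ in the norm dual $\mathfrak{A}^*$ of $\mathfrak{A}$.
   Formalization: The formal theorem additionally assumes that the three double integrals in the identity exist as absolutely convergent iterated Bochner integrals; the stated hypotheses do not guarantee this (e.g. T the real line with Lebesgue measure, α=1, A_t=exp(-t²), B=0). *)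

(* Defs.v *)
From HB Require Import structures.
From mathcomp Require Import all_boot all_order all_algebra.
From mathcomp Require Import complex.
From mathcomp Require Import all_classical all_reals all_analysis.

Set Implicit Arguments.
Unset Strict Implicit.
Unset Printing Implicit Defensive.

Import Order.TTheory GRing.Theory Num.Theory.
Import numFieldNormedType.Exports.

Local Open Scope classical_set_scope.
Local Open Scope ring_scope.
Local Open Scope complex_scope.

(* C*-algebras are not assumed to be unital, so the product is not a MathComp
   ring structure. Norms over R[i] take their (real) values in R[i]. *)
HB.mixin Record CompleteNormedModule_isCStarAlgebra (R : realType) A
    & CompleteNormedModule R[i] A := {
  cmul : A -> A -> A ;
  star : A -> A ;
  cmulA : associative cmul ;
  cmulDl : left_distributive cmul +%R ;
  cmulDr : right_distributive cmul +%R ;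
  cmulZl : forall (a : R[i]) (x y : A), cmul (a *: x) y = a *: cmul x y ;
  cmulZr : forall (a : R[i]) (x y : A), cmul x (a *: y) = a *: cmul x y ;
  ler_norm_cmul : forall x y : A, `|cmul x y| <= `|x| * `|y| ;
  starK : involutive star ;
  starD : {morph star : x y / x + y} ;
  starZ : forall (a : R[i]) (x : A), star (a *: x) = a^* *: star x ;
  starM : forall x y : A, star (cmul x y) = cmul (star y) (star x) ;
  norm_star_cmul : forall x : A, `|cmul (star x) x| = `|x| ^+ 2
}.

#[short(type="cstarAlgType")]
HB.structure Definition CStarAlgebra (R : realType) :=
  {A of CompleteNormedModule R[i] A &
        CompleteNormedModule_isCStarAlgebra R A}.

(* [abs2 x] is |x|^2 for |x| = (x^* x)^(1/2). *)
Definition abs2 (R : realType) (A : cstarAlgType R) (x : A) : A :=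
  cmul (star x) x.

Definition rnorm (R : realType) (V : normedModType R[i]) (x : V) : R :=
  complex.Re `|x|.

Notation borel T := (g_sigma_algebraType (@open T)).

(* Finite on compact sets, outer regular on Borel sets, inner regular on open
   sets. *)
Definition radon (R : realType) (T : ptopologicalType)
    (mu : {measure set (borel T) -> \bar R}) : Prop :=
  [/\ forall K : set T, compact K -> (mu K < +oo)%E,
      forall E : set (borel T), measurable E ->
        mu E = ereal_inf [set mu U | U in [set U : set T | open U /\ E `<=` U]] &
      forall U : set T, open U ->
        mu U =
        ereal_sup [set mu K | K in [set K : set T | compact K /\ K `<=` U]]].

Section complex_valued.
Context (R : realType) (d : measure_display) (T : measurableType d).

Definition cmeasurable (f : T -> R[i]) : Prop :=
  measurable_fun setT (fun t => complex.Re (f t)) /\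
  measurable_fun setT (fun t => complex.Im (f t)).

Variable mu : {measure set T -> \bar R}.

Definition cintegrable (f : T -> R[i]) : Prop :=
  mu.-integrable setT (fun t => (complex.Re (f t))%:E) /\
  mu.-integrable setT (fun t => (complex.Im (f t))%:E).

Definition cintegral (f : T -> R[i]) : R[i] :=
  (\int[mu]_t complex.Re (f t)) +i* (\int[mu]_t complex.Im (f t)).

End complex_valued.

Section bochner.
Context (R : realType) (d : measure_display) (T : measurableType d).
Variables (mu : {measure set T -> \bar R}) (V : normedModType R[i]).

Definition norm_integrable (f : T -> V) : Prop :=
  mu.-integrable setT (fun t => (rnorm (f t))%:E).

(* x is the integral of the norm-integrable field f: phi x = \int phi (f t)
   for every phi in the norm dual of V. *)
Definition has_bochner (f : T -> V) (x : V) : Prop :=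
  norm_integrable f /\
  forall phi : {linear V -> R[i]^o}, continuous phi ->
    cintegrable mu (phi \o f) /\ phi x = cintegral mu (phi \o f).

Definition bochner_integrable (f : T -> V) : Prop :=
  exists x, has_bochner f x.

(* There is at most one x with [has_bochner f x] (Hahn-Banach); the value is
   the junk value 0 when there is none. *)
Definition bochner (f : T -> V) : V := xget 0 [set x | has_bochner f x].

(* \int_T \int_T F t s dmu(t) dmu(s): the inner variable is t. *)
Definition bochner2 (F : T -> T -> V) : V :=
  bochner (fun s => bochner (fun t => F t s)).

(* The iterated integral [bochner2 F] exists and converges absolutely. *)
Definition bochner2_integrable (F : T -> T -> V) : Prop :=
  [/\ {ae mu, forall s, bochner_integrable (fun t => F t s)},
      bochner_integrable (fun s => bochner (fun t => F t s)) &
      (\int[mu]_s \int[mu]_t (rnorm (F t s))%:E < +oo)%E].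

End bochner.

(* Main.v *)
Require Import Defs.
From HB Require Import structures.
From mathcomp Require Import all_boot all_order all_algebra.
From mathcomp Require Import complex finmap.
From mathcomp Require Import all_classical all_reals all_analysis.
From mathcomp Require Import measurable_realfun.
From mathcomp Require Import ring lra.

Set Implicit Arguments.
Unset Strict Implicit.
Unset Printing Implicit Defensive.

Import Order.TTheory GRing.Theory Num.Theory.
Import numFieldNormedType.Exports.

Local Open Scope classical_set_scope.
Local Open Scope ring_scope.
Local Open Scope complex_scope.

(* Since conj(alpha(t,s)) alpha(s,t) = 1, expanding the squares gives
   |alpha(t,s) U_t - alpha(s,t) V_s|^2
     = |alpha(t,s)|^2 |U_t|^2 + |alpha(s,t)|^2 |V_s|^2 - U_t^* V_s - V_s^* U_t,
   and the mixed terms integrate to (int U)^* (int V) + (int V)^* (int U). What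
   remains, summed over (U,V) = (A,A), (B,B) and subtracted twice for (A,B), is
   antisymmetric in (t,s), so that it vanishes by Fubini's theorem.
   Everything is tested against real parts of continuous functionals, which
   separate points by the Hahn-Banach theorem. Fubini's theorem needs a
   sigma-finite measure: if A or B is not almost everywhere 0, absolute
   convergence of the double integrals forces mu to be sigma-finite, because
   alpha vanishes nowhere; otherwise all integrals are 0. *)

(** * The norm as a real number *)

Lemma ReZ (R : rcfType) (r : R) (z : R[i]) :
  complex.Re (r%:C * z) = r * complex.Re z.
Proof. by case: z => a b /=; rewrite mul0r subr0. Qed.

Section rnorm.
Context {R : realType} {V : normedModType R[i]}.
Implicit Types (x y : V) (r : R).

Lemma norm_rnorm x : `|x| = (rnorm x)%:C.
Proof. by rewrite /rnorm RRe_real. Qed.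

Lemma rnorm_ge0 x : 0 <= rnorm x.
Proof. by rewrite -lecR -norm_rnorm normr_ge0. Qed.

Lemma rnorm0 : rnorm (0 : V) = 0.
Proof. by rewrite /rnorm normr0. Qed.

Lemma rnorm_eq0 x : (rnorm x == 0) = (x == 0).
Proof. by rewrite -(normr_eq0 x) norm_rnorm -(inj_eq (@complexI R)). Qed.

Lemma ler_rnormD x y : rnorm (x + y) <= rnorm x + rnorm y.
Proof. by rewrite -lecR rmorphD/= -!norm_rnorm ler_normD. Qed.

Lemma rnormN x : rnorm (- x) = rnorm x.
Proof. by rewrite /rnorm normrN. Qed.

Lemma ler_rnormB x y : rnorm (x - y) <= rnorm x + rnorm y.
Proof. by rewrite -(rnormN y) ler_rnormD. Qed.

Lemma rnormZ r x : rnorm (r%:C *: x) = `|r| * rnorm x.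
Proof. by rewrite /rnorm normrZ normc_def/= expr0n/= addr0 sqrtr_sqr ReZ. Qed.

End rnorm.

(** * The Hahn-Banach theorem for real-linear functionals *)

Section hahn_banach.
Context {R : realType} {V : normedModType R[i]}.
Implicit Types (p q psi : V -> R) (x y : V).

(** Only real scalars occur: [V] is regarded as a real vector space. *)
Definition sublinear p :=
  (forall x y, p (x + y) <= p x + p y) /\
  (forall (r : R) x, 0 <= r -> p (r%:C *: x) = r * p x).

Lemma sublinear0 p : sublinear p -> p 0 = 0.
Proof. by case=> _ /(_ 0 0 (lexx 0)); rewrite scaler0 mul0r. Qed.

Lemma sublinearN_ge p x : sublinear p -> - p (- x) <= p x.
Proof.
move=> sp; rewrite -subr_ge0 opprK -(sublinear0 sp) -(subrr x).
by case: sp => /(_ x (- x)).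
Qed.

(* The largest sublinear [q <= p] that satisfies [q (- y) <= - p y]. *)
Let tilt p y x :=
  inf [set p (x + t%:C *: y) - t * p y | t in [set t : R | 0 <= t]].

Let tilt_lb p y x : sublinear p ->
  lbound [set p (x + t%:C *: y) - t * p y | t in [set t : R | 0 <= t]]
         (- p (- x)).
Proof.
move=> sp _ [t /= t0 <-]; rewrite lerBrDr addrC -lerBrDr opprK.
by case: sp => spD <-//; rewrite -{1}(addKr x (t%:C *: y)) addrC spD.
Qed.

Let tilt_le p y x (t : R) : sublinear p -> 0 <= t ->
  tilt p y x <= p (x + t%:C *: y) - t * p y.
Proof.
move=> sp t0; apply: ge_inf; last by exists t.
by exists (- p (- x)); exact: tilt_lb.
Qed.

Let tilt_ge p y x (c : R) :
  (forall t, 0 <= t -> c <= p (x + t%:C *: y) - t * p y) -> c <= tilt p y x.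
Proof.
move=> cp; apply: lb_le_inf; first by exists (p (x + 0%:C *: y) - 0 * p y), 0 => /=.
by move=> _ [t /= t0 <-]; exact: cp.
Qed.

(** If [t] is used for [x] and [u] for [z], then [t + u] is admissible for [x + z]. For [r > 0], the
    substitution of [r * t] for [t] exchanges the infima for [x] and [r x]; [r = 0] is treated
    apart. *)
Let tilt_sublinear p y : sublinear p -> sublinear (tilt p y).
Proof.
move=> sp; have [spD spZ] := sp; split=> [x z|r x].
  rewrite -lerBlDr; apply/tilt_ge => t t0.
  rewrite lerBlDl -lerBlDr; apply/tilt_ge => u u0.
  rewrite lerBlDl (le_trans (tilt_le y (x + z) sp (addr_ge0 t0 u0)))//.
  rewrite rmorphD/= scalerDl addrACA (le_trans (lerB (spD _ _) (lexx _)))//.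
  by rewrite mulrDl opprD addrACA.
rewrite le_eqVlt => /predU1P[<-|r0].
  rewrite mul0r scale0r; apply/le_anti/andP; split.
    by rewrite (le_trans (tilt_le y 0 sp (lexx 0)))// scale0r addr0 sublinear0// mul0r subr0.
  by apply/tilt_ge => t t0; rewrite add0r spZ// subrr.
apply/le_anti/andP; split.
  rewrite -ler_pdivrMl//; apply/tilt_ge => t t0.
  rewrite ler_pdivrMl// mulrBr -spZ ?(ltW r0)// scalerDr scalerA -rmorphM/= mulrA.
  by apply: tilt_le => //; rewrite mulr_ge0// ltW.
apply/tilt_ge => t t0; rewrite -ler_pdivlMl// mulrBr -spZ ?invr_ge0 ?(ltW r0)//.
rewrite scalerDr !scalerA -!rmorphM/= mulVf ?gt_eqF// scale1r mulrA.
by apply: tilt_le => //; rewrite mulr_ge0// invr_ge0 ltW.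
Qed.

Let tilt_le0 p y x : sublinear p -> tilt p y x <= p x.
Proof.
move=> sp; rewrite (le_trans (tilt_le y x sp (lexx 0)))//.
by rewrite scale0r addr0 mul0r subr0.
Qed.

Let tilt_le1 p y x : sublinear p -> tilt p y x <= p (x + y) - p y.
Proof. by move=> /(tilt_le y x)/(_ ler01); rewrite scale1r mul1r. Qed.

(** Zorn's lemma: a nonempty chain of sublinear functionals below [p] has its pointwise infimum as a
    lower bound, which is finite because every member is at least [- p (- x)] at [x]. *)
Lemma minimal_sublinear p : sublinear p ->
  exists2 q, sublinear q /\ (forall x, q x <= p x) &
    forall q', sublinear q' -> (forall x, q' x <= q x) -> q' = q.
Proof.
move=> sp.
pose T := {q : V -> R | sublinear q /\ forall x, q x <= p x}.
(* The order is reversed, so that a maximal element is a minimal functional. *)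
pose le (q q' : T) : bool := `[< forall x, sval q' x <= sval q x >].
have [||| q] := @ZL_preorder T (exist _ p (conj sp (fun=> lexx _))) le.
- by move=> q; apply/asboolP => x.
- move=> q q' q'' /asboolP h /asboolP h'; apply/asboolP => x.
  exact: le_trans (h' x) (h x).
- move=> A totA; have [->|/set0P[q0 Aq0]] := eqVneq A set0.
    by exists (exist _ p (conj sp (fun=> lexx _))).
  pose m x := inf [set sval q x | q in A].
  have m_lb x : lbound [set sval q x | q in A] (- p (- x)).
    move=> _ [[q [sq qp]] /= _ <-]; rewrite (le_trans _ (sublinearN_ge x sq))//.
    by rewrite lerN2.
  have m_le x (q : T) : A q -> m x <= sval q x.
    by move=> Aq; apply: ge_inf; [exists (- p (- x))|exists q].
  have m_ge x (c : R) : (forall q : T, A q -> c <= sval q x) -> c <= m x.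
    move=> cA; apply: lb_le_inf; first by exists (sval q0 x), q0.
    by move=> _ [q Aq <-]; exact: cA.
  have sm : sublinear m.
    split=> [x y|r x].
      rewrite -lerBlDr; apply/m_ge => q Aq.
      rewrite lerBlDl -lerBlDr; apply/m_ge => q' Aq'; rewrite lerBlDl.
      (* The smaller of the two chain members, evaluated at [x + y], bounds [m (x + y)], and its own
         subadditivity gives the estimate. *)
      have [/asboolP qq'|/asboolP qq'] := totA _ _ Aq Aq'.
        rewrite (le_trans (m_le _ _ Aq'))//.
        by rewrite (le_trans ((svalP q').1.1 x y))// lerD2r.
      rewrite (le_trans (m_le _ _ Aq))//.
      by rewrite (le_trans ((svalP q).1.1 x y))// lerD2l.
    rewrite le_eqVlt => /predU1P[<-|r0].
      rewrite mul0r scale0r; apply/le_anti/andP; split.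
        by rewrite (le_trans (m_le _ _ Aq0))// sublinear0//; case: (svalP q0).
      by apply/m_ge => q _; rewrite sublinear0//; case: (svalP q).
    have mZ (q : T) : sval q (r%:C *: x) = r * sval q x.
      by case: (svalP q) => -[_ ->]//; exact: ltW.
    apply/le_anti/andP; split.
      rewrite -ler_pdivrMl//; apply/m_ge => q Aq.
      by rewrite ler_pdivrMl// -mZ m_le.
    by apply/m_ge => q Aq; rewrite mZ ler_pM2l// m_le.
  have mp x : m x <= p x.
    by rewrite (le_trans (m_le _ _ Aq0))//; case: (svalP q0).
  by exists (exist _ m (conj sm mp)) => q Aq; apply/asboolP => x; exact: m_le.
- move=> qmin; exists (sval q); first exact: (svalP q).
  move=> q' sq' q'q.
  have q'p x : q' x <= p x by rewrite (le_trans (q'q x))//; case: (svalP q).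
  have /qmin/asboolP qq' : le q (exist _ q' (conj sq' q'p)) by apply/asboolP.
  by apply/funext => x; apply/le_anti/andP; split; [exact: q'q|exact: qq'].
Qed.

(** These are the real parts of the continuous complex-linear functionals. *)
Definition rfunctional psi :=
  [/\ {morph psi : x y / x + y},
      forall (r : R) x, psi (r%:C *: x) = r * psi x &
      exists2 C, 0 < C & forall x, `|psi x| <= C * rnorm x].

Lemma rfunctionalN psi x : rfunctional psi -> psi (- x) = - psi x.
Proof.
by case=> _ Z _; rewrite -scaleN1r -(rmorph1 (real_complex R)) -rmorphN Z mulN1r.
Qed.

Lemma rfunctionalB psi x y : rfunctional psi -> psi (x - y) = psi x - psi y.
Proof. by move=> fpsi; case: (fpsi) => -> _ _; rewrite rfunctionalN. Qed.

(* A minimal sublinear functional is linear, as it cannot be tilted. *)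
Lemma norming_functional x : exists psi,
  [/\ rfunctional psi, forall y, `|psi y| <= rnorm y & psi x = rnorm x].
Proof.
have sN : sublinear (@rnorm R V).
  split=> [y z|r y r0]; first exact: ler_rnormD.
  by rewrite rnormZ ger0_norm.
(* Starting below the norm tilted at [x], rather than below the norm itself, forces the value
   [rnorm x] at [x]. *)
have [q [sq qN] qmin] := minimal_sublinear (tilt_sublinear x sN).
have qy y z : q z <= q (z + y) - q y.
  rewrite -{1}(qmin _ (tilt_sublinear y sq)) ?tilt_le1// => w.
  exact: tilt_le0.
have qD : {morph q : y z / y + z}.
  move=> y z; apply/le_anti/andP; split; first exact: sq.1.
  by rewrite -lerBrDr.
have qNN y : q (- y) = - q y.
  by apply/eqP; rewrite -subr_eq0 opprK -qD addNr sublinear0.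
have qle y : q y <= rnorm y by rewrite (le_trans (qN y))// tilt_le0.
have qnorm y : `|q y| <= rnorm y.
  by rewrite ler_norml qle andbT lerNl -qNN -rnormN qle.
exists q; split=> //.
  split=> //; last by exists 1 => // y; rewrite mul1r.
  move=> r y; have [r0|r0] := leP 0 r; first exact: sq.2.
  by rewrite -[r]opprK rmorphN/= scaleNr qNN sq.2 ?oppr_ge0 ?(ltW r0)// !mulNr.
(* The tilt at [- x] with parameter 1 is at most [rnorm 0 - rnorm x], hence
   [q (- x) <= - rnorm x]. *)
apply/le_anti; rewrite qle/= -lerN2 -qNN (le_trans (qN (- x)))//.
by rewrite (le_trans (tilt_le1 _ _ sN))// addNr rnorm0 sub0r.
Qed.

Lemma rfunctional_separate x y :
  (forall psi, rfunctional psi -> psi x = psi y) -> x = y.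
Proof.
move=> xy; have [psi [fpsi _]] := norming_functional (x - y).
rewrite rfunctionalB// xy// subrr.
by move/esym/eqP; rewrite rnorm_eq0 subr_eq0 => /eqP.
Qed.

End hahn_banach.

(** * Passing between real and complex functionals *)

Lemma ler_norm_ReIm (R : rcfType) (z : R[i]) :
  `|z| <= (`|complex.Re z| + `|complex.Im z|)%:C.
Proof.
rewrite {1}[z]complexE (le_trans (ler_normD _ _))// normrM normCi mul1r.
by rewrite !normc_def/= expr0n/= !addr0 !sqrtr_sqr rmorphD.
Qed.

Section complexification.
Context {R : realType} {V : normedModType R[i]}.

Let scaleE (a : R[i]) (x : V) :
  a *: x = (complex.Re a)%:C *: x + (complex.Im a)%:C *: ('i%C *: x).
Proof. by rewrite scalerA -scalerDl mulrC {1}[a]complexE. Qed.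

(** The functional is $x \mapsto \psi(x) - i\psi(ix)$, complex-linear because $i(ix) = -x$. Bounding
    its real and imaginary parts by [C] each gives the constant [C + C]. *)
Lemma rfunctional_Re (psi : V -> R) : rfunctional psi ->
  exists2 phi : {linear V -> R[i]^o}, continuous phi &
    forall x, complex.Re (phi x) = psi x.
Proof.
move=> fpsi; have [D Z [C C0 psiC]] := fpsi.
pose phi (x : V) : R[i]^o := psi x +i* - psi ('i%C *: x).
have iiN (x : V) : 'i%C *: ('i%C *: x) = - x.
  by rewrite scalerA -expr2 sqr_i scaleN1r.
have phi_lin : linear phi.
  move=> a x y; rewrite /phi scaleE scalerDr !scalerDr.
  rewrite [X in 'i%C *: X]/=.
  rewrite !(scalerA 'i%C) ![_ * _%:C]mulrC -!scalerA iiN.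
  rewrite !D !Z rfunctionalN//.
  case: a => a b /=; apply/eqP; rewrite eq_complex/=.
  by apply/andP; split; apply/eqP; ring.
pose phiL := HB.pack_for {linear V -> R[i]^o} phi
  (GRing.isLinear.Build _ _ _ _ phi phi_lin).
exists phiL => //; apply/linear_bounded_continuous/linear_boundedP.
exists (C + C)%:C; split; first by rewrite ger0_real// lecR addr_ge0// ltW.
move=> r Cr x; rewrite (le_trans _ (ler_wpM2r _ (ltW Cr)))//.
rewrite (norm_rnorm x) -rmorphM/= (le_trans (ler_norm_ReIm _))//= lecR mulrDl normrN.
rewrite lerD// (le_trans (psiC _))//.
by rewrite /rnorm normrZ normCi mul1r.
Qed.

Lemma Re_rfunctional (phi : {linear V -> R[i]^o}) : continuous phi ->
  rfunctional (fun x => complex.Re (phi x)) /\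
  rfunctional (fun x => complex.Im (phi x)).
Proof.
move=> /linear_bounded_continuous/linear_boundedP/pinfty_ex_gt0[C C0 phiC].
have CE : C = (complex.Re C)%:C by rewrite RRe_real// gtr0_real.
have ReC0 : 0 < complex.Re C by rewrite -ltcR -CE.
split; split=> [x y|r x|]; rewrite ?linearD ?linearZ/=.
- by case: (phi x) (phi y) => [a b] [].
- by rewrite ReZ.
- exists (complex.Re C) => // x; rewrite -lecR rmorphM/= -CE -norm_rnorm.
  exact: le_trans (normc_ge_Re _) (phiC x).
- by case: (phi x) (phi y) => [a b] [].
- by case: (phi x) => a b /=; rewrite mul0r addr0.
- exists (complex.Re C) => // x; rewrite -lecR rmorphM/= -CE -norm_rnorm.
  rewrite (le_trans _ (phiC x))// normc_def lecR -sqrtr_sqr.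
  by rewrite ler_wsqrtr// lerDr sqr_ge0.
Qed.

End complexification.

(** * Bochner integrals tested against real functionals *)

Section bochner.
Context {R : realType} {d : measure_display} {T : measurableType d}.
Context {mu : {measure set T -> \bar R}} {V : normedModType R[i]}.
Implicit Types (f g : T -> V) (x y : V).

(** Real functionals suffice, since the real and imaginary parts of a continuous complex functional
    are both of this kind. All later arguments use this form. *)
Lemma has_bochnerP f x : has_bochner mu f x <-> norm_integrable mu f /\
  forall psi, rfunctional psi ->
    mu.-integrable setT (fun t => (psi (f t))%:E) /\
    psi x = \int[mu]_t psi (f t).
Proof.
split=> -[fi fx]; split=> //.
  move=> psi /rfunctional_Re[phi cphi phiE].
  have [[iphi _]] := fx _ cphi; rewrite /cintegral => /(congr1 (@complex.Re R)).
  rewrite phiE/= => ->; split.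
    by apply: eq_integrable iphi => //= t _; rewrite phiE.
  by apply: eq_Rintegral => t _; rewrite phiE.
move=> phi /Re_rfunctional[/fx[iRe ReE] /fx[iIm ImE]].
by split=> //; rewrite /cintegral -ReE -ImE; case: (phi x).
Qed.

Lemma has_bochner_inj f x y : has_bochner mu f x -> has_bochner mu f y -> x = y.
Proof.
move=> /has_bochnerP[_ fx] /has_bochnerP[_ fy].
by apply: rfunctional_separate => psi fpsi; rewrite (fx _ fpsi).2 (fy _ fpsi).2.
Qed.

Lemma bochnerE f x : has_bochner mu f x -> bochner mu f = x.
Proof.
move=> fx; rewrite /bochner; case: xgetP => [y _ /= fy|/(_ x)//].
exact: has_bochner_inj fy fx.
Qed.

Lemma bochnerP f : bochner_integrable mu f -> has_bochner mu f (bochner mu f).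
Proof. by move=> [x fx]; rewrite (bochnerE fx). Qed.

Lemma has_bochner_ae0 f x : {ae mu, forall t, f t = 0} ->
  has_bochner mu f x -> x = 0.
Proof.
move=> f0 /has_bochnerP[_ fx]; apply: rfunctional_separate => psi fpsi.
have psi0 : psi 0 = 0 by rewrite -(subrr 0) rfunctionalB// subrr.
have [/integrableP[mf _] ->] := fx _ fpsi.
rewrite psi0 /Rintegral (ae_eq_integral (cst 0%E))// ?integral0//.
by apply: filterS f0 => t /= -> _; rewrite psi0.
Qed.

End bochner.

(** * Approximation of integrals over sets of finite measure *)

Section finite_cover.
Context {R : realType} {d : measure_display} {T : measurableType d}.
Context {mu : {measure set T -> \bar R}} {V : normedModType R[i]}.

(** Here [x] is the integral of a simple function: going through the list, the part of [E] not yet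
    treated where [f] is within [e] of [v] contributes its measure times [v]. The point is that a
    single [x] serves all functionals of norm at most 1. *)
Lemma integral_finite_cover (f : T -> V) (e : R) (s : seq V) (E : set T) :
  (forall v, measurable_fun setT (fun t => rnorm (f t - v))) ->
  measurable E -> (mu E < +oo)%E ->
  (forall t, E t -> exists2 v, v \in s & rnorm (f t - v) <= e) ->
  exists x, forall psi, rfunctional psi -> (forall y, `|psi y| <= rnorm y) ->
    mu.-integrable setT (fun t => (psi (f t))%:E) ->
    `|\int[mu]_(t in E) psi (f t) - psi x| <= e * fine (mu E).
Proof.
move=> mf; elim: s E => [|v s IH] E mE Efin Es.
  have -> : E = set0 by rewrite -subset0 => t /Es[].
  exists 0 => psi fpsi psi1 _; rewrite Rintegral_set0 measure0 mulr0.
  by rewrite -(subrr (0 : V)) rfunctionalB// !subrr normr0.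
pose E1 := E `&` [set t | rnorm (f t - v) <= e].
have mE1 : measurable E1.
  rewrite /E1 -[X in _ `&` X]setTI; apply: measurableI => //.
  by have := mf v measurableT _ (measurable_itv `]-oo, e]); rewrite set_itvE.
have mE2 : measurable (E `\` E1) by exact: measurableD.
have E1fin : (mu E1 < +oo)%E.
  by apply: le_lt_trans Efin; apply: le_measure; rewrite ?inE//; exact: subIsetl.
have E2fin : (mu (E `\` E1) < +oo)%E.
  by apply: le_lt_trans Efin; apply: le_measure; rewrite ?inE//; exact: subDsetl.
have [t [Et nE1t]|x xE2] := IH _ mE2 E2fin.
  have [w + fw] := Es _ Et; rewrite inE => /predU1P[wv|ws]; last by exists w.
  by exfalso; apply: nE1t; split=> //=; rewrite -wv.
have EE : E = E1 `|` (E `\` E1) by rewrite setDUK//; exact: subIsetl.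
have disj : [disjoint E1 & E `\` E1] by apply/disj_setPS => t [? []].
exists (x + (fine (mu E1))%:C *: v) => psi fpsi psi1 ipsi.
have [D Z _] := fpsi.
have iE1 : mu.-integrable E1 (EFin \o (psi \o f)) by exact: integrableS ipsi.
rewrite EE Rintegral_setU -?EE//; last exact: integrableS ipsi.
have -> : e * fine (mu E) = e * fine (mu (E `\` E1)) + fine (mu E1) * e.
  rewrite [in LHS]EE measureU//; last exact/disj_set2P.
  by rewrite fineD ?ge0_fin_numE//; ring.
rewrite D Z [X in `|X - _|]addrC opprD addrACA (le_trans (ler_normD _ _))//.
rewrite lerD ?xE2// mulrC -Rintegral_cst//.
have icst (c : R) : mu.-integrable E1 (EFin \o cst c).
  apply/integrableP; split; first exact/measurable_EFinP.
  by rewrite (eq_integral (cst `|c|%:E))// integral_cst// lte_mul_pinfty.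
have ipsiB : mu.-integrable E1 (EFin \o (fun t => psi (f t) - psi v)).
  exact: (integrableB mE1 iE1 (icst (psi v))).
rewrite -RintegralB//; last exact: (icst (psi v)).
rewrite (le_trans (le_normr_Rintegral _ ipsiB))//.
rewrite [leRHS]mulrC -Rintegral_cst//.
apply: (le_Rintegral mE1 (integrable_norm ipsiB) (icst e)) => t [_ /=].
by apply: le_trans; rewrite -rfunctionalB//; exact: psi1.
Qed.

End finite_cover.

(** Chebyshev's inequality. *)
Lemma integrable_superlevel_lty (R : realType) (d : measure_display)
    (T : measurableType d) (mu : {measure set T -> \bar R}) (g : T -> R) (c : R) :
  mu.-integrable setT (fun t => (g t)%:E) -> 0 < c ->
  measurable (setT `&` [set t | c%:E <= `|(g t)%:E|]%E) /\
  (mu (setT `&` [set t | c%:E <= `|(g t)%:E|]%E) < +oo)%E.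
Proof.
move=> /integrableP[mg gi] c0; split.
  by apply: emeasurable_fun_c_infty => //; exact: measurableT_comp.
have := le_lt_trans (le_integral_abse mu measurableT mg c0) gi.
set S := setI _ _ => cS; rewrite ltey; apply: contraTneq cS => ->.
by rewrite gt0_muley ?lte_fin// ltxx.
Qed.

(** * Borel measurability of continuous functions *)

Section borel.
Context {R : realType} {T : ptopologicalType}.

Lemma open_borel (U : set T) : open U -> measurable (U : set (borel T)).
Proof. by move=> oU; apply: sub_sigma_algebra. Qed.

Lemma compact_borel (K : set T) : hausdorff_space T -> compact K ->
  measurable (K : set (borel T)).
Proof.
move=> hT /(compact_closed hT) cK; rewrite -[K]setCK; apply: measurableC.
by apply: open_borel; rewrite openC.
Qed.

Lemma continuous_borel (g : T -> R) : continuous g ->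
  measurable_fun setT (g : borel T -> R).
Proof.
move=> /continuousP cg; apply: (measurability _ (RGenOpens.measurableE R)).
move=> _ [_ [a [b ->] <-]]; rewrite setTI; apply: open_borel.
exact/cg/interval_open.
Qed.

Lemma continuous_lipschitz_comp (V : normedModType R[i]) (f : T -> V)
    (g : V -> R) (C : R) :
  (forall x y, `|g x - g y| <= C * rnorm (x - y)) -> continuous f ->
  continuous (g \o f).
Proof.
move=> gC cf t; apply/cvgrPdist_le => e e0.
(* [C] has no prescribed sign; this is a positive Lipschitz constant to divide by. *)
have C0 : 0 < `|C| + 1 by rewrite ltr_wpDl.
have /cvgrPdist_le/(_ (e / (`|C| + 1))%:C) := cf t.
rewrite ltcR divr_gt0// => /(_ isT); apply: filterS => s.
rewrite norm_rnorm lecR ler_pdivlMr// => fts; rewrite (le_trans (gC _ _))//.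
rewrite (le_trans _ fts)// mulrC ler_wpM2l ?rnorm_ge0//.
by rewrite (le_trans (ler_norm C))// lerDl.
Qed.

Lemma continuous_rnorm (V : normedModType R[i]) (f : T -> V) :
  continuous f -> continuous (fun t => rnorm (f t)).
Proof.
apply: (@continuous_lipschitz_comp V f (@rnorm R V) 1) => x y.
have h1 : rnorm x <= rnorm (x - y) + rnorm y by rewrite -{1}(subrK y x) ler_rnormD.
have h2 : rnorm y <= rnorm (x - y) + rnorm x.
  by rewrite -(rnormN (x - y)) opprB -{1}(subrK x y) ler_rnormD.
by rewrite mul1r ler_norml; apply/andP; split; lra.
Qed.

Lemma continuous_rfunctional (V : normedModType R[i]) (f : T -> V)
    (psi : V -> R) :
  rfunctional psi -> continuous f -> continuous (psi \o f).
Proof.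
move=> fpsi; have [_ _ [C _ psiC]] := fpsi.
by apply: (@continuous_lipschitz_comp _ _ _ C) => x y; rewrite -rfunctionalB.
Qed.

End borel.

(** * Existence of the Bochner integral of a continuous field *)

Section radon.
Context {R : realType} {T : ptopologicalType}.
Context (mu : {measure set (borel T) -> \bar R}) (V : completeNormedModType R[i]).
Hypotheses (hT : hausdorff_space T) (mu_radon : radon mu).
Variable f : T -> V.
Hypotheses (cf : continuous f) (fi : norm_integrable mu f).

Let mf : measurable_fun (setT : set (borel T)) (fun t => rnorm (f t)).
Proof. by apply: continuous_borel; exact: continuous_rnorm. Qed.

(** The sets [W n] exhaust the set where [f] is nonzero. The lower bound makes their measure finite,
    and the upper bound turns a small measure into a small integral. *)
Let W n := [set t : T | n.+1%:R^-1 < rnorm (f t) < n.+1%:R].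

Let W_open n : open (W n).
Proof.
have oI := @interval_open R (BRight n.+1%:R^-1) (BLeft n.+1%:R) isT isT.
have /continuousP/(_ _ oI) := continuous_rnorm cf.
by congr open; apply/seteqP; split => t /=; rewrite in_itv.
Qed.

Let W_fin n : (mu (W n) < +oo)%E.
Proof.
have n0 : 0 < n.+1%:R^-1 :> R by rewrite invr_gt0.
have [mS] := integrable_superlevel_lty fi n0.
apply: le_lt_trans; apply: le_measure; rewrite ?inE//.
  exact: (open_borel (W_open n)).
move=> t /= /andP[nf _]; split=> //=.
by rewrite lee_fin ger0_norm ?rnorm_ge0// ltW.
Qed.

(** Dominated convergence gives [n] with tail at most [e / 2] outside [W n]; inner regularity of the
    open set [W n] then gives a compact [K] inside it that loses at most another [e / 2]. *)
Let compact_tail (e : R) : 0 < e -> exists K : set T,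
  [/\ compact K, (mu K < +oo)%E &
      (\int[mu]_(t in ~` K) (rnorm (f t))%:E <= e%:E)%E].
Proof.
move=> e0; have e20 : 0 < e / 2 by rewrite divr_gt0.
pose h n := (fun t : borel T => (rnorm (f t))%:E) \_ (~` W n).
have mWC n : measurable (~` W n : set (borel T)).
  exact: measurableC (open_borel (W_open n)).
have mfE : measurable_fun setT (fun t : borel T => (rnorm (f t))%:E).
  exact/measurable_EFinP.
have [] := @dominated_convergence _ _ _ mu setT measurableT h (cst 0%E)
  (fun t => (rnorm (f t))%:E).
- by move=> n; apply/(measurable_restrictT _ _).1 => //; exact: measurable_funTS.
- by [].
- apply/aeW => t _; apply: cvg_near_cst.
  have [ft0|ft0] := eqVneq (rnorm (f t)) 0.
    by near=> n; rewrite /h patchE; case: ifP => // _; rewrite ft0.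
  have ftgt0 : 0 < rnorm (f t) by rewrite lt_def ft0 rnorm_ge0.
  near=> n; rewrite /h patchE ifF//; apply/negbTE; rewrite in_setC negbK inE.
  rewrite /W/=; apply/andP; split.
    rewrite invf_plt ?posrE// (@lt_le_trans _ _ n%:R) ?ler_nat//.
    by near: n; exact: nbhs_infty_gtr.
  rewrite (@lt_le_trans _ _ n%:R) ?ler_nat//.
  by near: n; exact: nbhs_infty_gtr.
- exact: fi.
- apply/aeW => t n _; rewrite /h patchE; case: ifP => _.
    by rewrite gee0_abs// lee_fin rnorm_ge0.
  by rewrite abse0 lee_fin rnorm_ge0.
move=> _ _; rewrite integral0 => /fine_cvgP[hfin hcvg].
have [n Wn] : exists n, (\int[mu]_t h n t <= (e / 2)%:E)%E.
  near \oo => n; exists n.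
  have hn : (\int[mu]_t h n t \is a fin_num)%E by near: n.
  rewrite -(fineK hn).
  by rewrite lee_fin ltW//; near: n; exact: (cvgr_lt _ hcvg).
have {}Wn : (\int[mu]_(t in ~` W n) (rnorm (f t))%:E <= (e / 2)%:E)%E.
  by rewrite integral_mkcond.
have [_ _ /(_ (W n) (W_open n)) muW] := mu_radon.
(* The norm of [f] is below [n.+1] on [W n], so a loss of measure at most this costs at most
   [e / 2]. *)
have delta0 : 0 < e / 2 / n.+1%:R by rewrite divr_gt0.
have muWfin : mu (W n) \is a fin_num by rewrite ge0_fin_numE// W_fin.
have := muWfin; rewrite {1}muW => /(ub_ereal_sup_adherent delta0).
rewrite -muW => -[_ [K [cK KW] <-]] muK.
have mK : measurable (K : set (borel T)) by exact: compact_borel.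
have mW : measurable (W n : set (borel T)) by exact: open_borel.
have muKfin : mu K \is a fin_num.
  by rewrite ge0_fin_numE// (le_lt_trans _ (W_fin n))// le_measure ?inE.
have muWK : (mu (W n `\` K) <= (e / 2 / n.+1%:R)%:E)%E.
  rewrite measureD// ?W_fin// (setIidr KW).
  by rewrite leeBlDr// addeC; move: muK; rewrite lteBlDr// => /ltW.
exists K; split=> //; first by rewrite ltey_eq muKfin.
have -> : ~` K = ~` W n `|` (W n `\` K) :> set (borel T).
  apply/seteqP; split=> t /=.
    by move=> nKt; have [Wt|] := pselect (W n t); [right|left].
  by case=> [nWt /KW//|[]].
rewrite ge0_integral_setU//; last 4 first.
- exact: measurableD.
- exact: measurable_funTS.
- by move=> t _; rewrite lee_fin rnorm_ge0.
- by apply/disj_setPS => t [] /= ? [].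
rewrite [e]splitr EFinD leeD//.
have -> : e / 2 = n.+1%:R * (e / 2 / n.+1%:R) by rewrite [RHS]mulrC divfK.
rewrite EFinM (le_trans _ (lee_wpmul2l _ muWK))//.
rewrite -integral_cst; last exact: measurableD.
apply: ge0_le_integral => //.
- exact: measurableD.
- by move=> t _; rewrite lee_fin rnorm_ge0.
- exact: measurable_funTS.
- by move=> t [/andP[_ /ltW]].
Unshelve. all: by end_near. Qed.

Let psi_integrable psi : rfunctional psi ->
  mu.-integrable setT (fun t => (psi (f t))%:E).
Proof.
move=> fpsi; have [_ _ [C C0 psiC]] := fpsi.
apply: (le_integrable measurableT _ _ (integrableZl measurableT C fi)).
  apply/measurable_EFinP; apply: continuous_borel.
  exact: continuous_rfunctional fpsi cf.
by move=> t _; rewrite lee_fin (le_trans (psiC _))// ler_norm.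
Qed.

Let bochner_approx (e : R) : 0 < e -> exists x : V,
  forall psi, rfunctional psi -> (forall y, `|psi y| <= rnorm y) ->
    `|\int[mu]_t psi (f t) - psi x| <= e.
Proof.
move=> e0; have e20 : 0 < e / 2 by rewrite divr_gt0.
have [K [cK Kfin Ktail]] := compact_tail e20.
have mK : measurable (K : set (borel T)) by exact: compact_borel.
have muK0 : 0 <= fine (mu K) by rewrite fine_ge0.
have K10 : 0 < fine (mu K) + 1 by rewrite ltr_wpDl.
(* Chosen so that [r * fine (mu K) <= e / 2]; adding 1 covers the case of measure 0. *)
pose r := e / 2 / (fine (mu K) + 1).
have r0 : 0 < r by rewrite divr_gt0.
have cfv v : continuous (fun t => rnorm (f t - v)).
  by apply: continuous_rnorm => t; apply: cvgB; [exact: cf|exact: cvg_cst].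
pose U t := [set s | rnorm (f s - f t) < r].
(* By compactness, finitely many values of [f] on [K] form an [r]-net of its image, as
   [integral_finite_cover] requires. *)
have [D' _ KD'] : finite_subset_cover K U K.
  have : cover_compact K by rewrite -compact_cover.
  apply.
    move=> t _; have oI := @interval_open R -oo%O (BLeft r) isT isT.
    have /continuousP/(_ _ oI) := cfv (f t).
    by congr open; apply/seteqP; split => s /=; rewrite in_itv.
  by move=> t Kt; exists t => //; rewrite /U/= subrr rnorm0.
have [|t Kt|x fx] := @integral_finite_cover R _ _ mu V f r
    (map f (enum_fset D')) K _ mK Kfin.
- by move=> v; apply: continuous_borel.
- have [s /= sD' Uts] := KD' _ Kt; exists (f s); last exact: ltW.
  by apply/mapP; exists s.
exists x => psi fpsi psi1; have ipsi := psi_integrable fpsi.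
have -> : \int[mu]_t psi (f t) =
    \int[mu]_(t in K) psi (f t) + \int[mu]_(t in ~` K) psi (f t).
  have KC : K `|` ~` K = setT :> set (borel T) by exact: setUv.
  have iKC : mu.-integrable (K `|` ~` K) (EFin \o (psi \o f)) by rewrite KC.
  have dKC : [disjoint K & ~` K :> set (borel T)] by apply/disj_setPS => t [].
  by rewrite -(Rintegral_setU mK (measurableC mK) iKC dKC) KC.
rewrite addrAC [e]splitr (le_trans (ler_normD _ _))// lerD//.
  rewrite (le_trans (fx _ fpsi psi1 ipsi))// /r -mulrA ler_piMr ?ltW//.
  by rewrite mulrC ltr_pdivrMr// mul1r ltrDl.
have ipsiC : mu.-integrable (~` K) (EFin \o (psi \o f)).
  exact: (integrableS measurableT (measurableC mK) (@subsetT _ _) ipsi).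
have ifC : mu.-integrable (~` K) (EFin \o (fun t => rnorm (f t))).
  exact: (integrableS measurableT (measurableC mK) (@subsetT _ _) fi).
rewrite (le_trans (le_normr_Rintegral (measurableC mK) ipsiC))//.
apply: (@le_trans _ _ (\int[mu]_(t in ~` K) rnorm (f t))).
  apply: (le_Rintegral (measurableC mK) (integrable_norm ipsiC) ifC) => t _.
  exact: psi1.
rewrite -lee_fin /Rintegral fineK//; exact: (integrable_fin_num (measurableC mK) ifC).
Qed.

(** The approximants of [bochner_approx] form a Cauchy sequence, since a norming functional computes
    the norm of a difference of two of them. The limit, which exists by completeness, is the
    integral. *)
Lemma continuous_bochner_integrable : bochner_integrable mu f.
Proof.
have /choice[x fx] : forall n : nat, exists x : V,
    forall psi, rfunctional psi -> (forall y, `|psi y| <= rnorm y) ->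
    `|\int[mu]_t psi (f t) - psi x| <= n.+1%:R^-1.
  by move=> n; apply: bochner_approx; rewrite invr_gt0.
have xx m n : rnorm (x m - x n) <= m.+1%:R^-1 + n.+1%:R^-1.
  have [psi [fpsi psi1 <-]] := norming_functional (x m - x n).
  rewrite rfunctionalB// (le_trans (ler_norm _))//.
  rewrite -[_ - _](subrKA (\int[mu]_t psi (f t))) (le_trans (ler_normD _ _))// lerD//.
    by rewrite distrC fx.
  exact: fx.
have /cvg_ex[l xl] : cvg (x @ \oo).
  apply/cauchy_cvgP/cauchy_exP => e e0.
  have eE : e = (complex.Re e)%:C by rewrite RRe_real// gtr0_real.
  have re0 : 0 < complex.Re e by rewrite -ltcR -eE.
  have re20 : 0 < complex.Re e / 2 by rewrite divr_gt0.
  near \oo => N; exists (x N).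
  change (\forall n \near \oo, ball (x N) e (x n)); near=> n.
  rewrite -ball_normE/= norm_rnorm eE ltcR (le_lt_trans (xx _ _))//.
  rewrite [ltRHS]splitr ltrD//; [near: N|near: n];
    exact: (near_infty_natSinv_lt (PosNum re20)).
have norm1 psi : rfunctional psi -> (forall y, `|psi y| <= rnorm y) ->
    psi l = \int[mu]_t psi (f t).
  move=> fpsi psi1; apply/eqP; rewrite -subr_eq0 -normr_le0.
  apply/ler_addgt0Pl => e e0; rewrite addr0.
  have e20 : 0 < e / 2 by rewrite divr_gt0.
  near \oo => n; rewrite -(subrKA (psi (x n))) (le_trans (ler_normD _ _))//.
  rewrite [e]splitr lerD//.
    rewrite -rfunctionalB// (le_trans (psi1 _))// -lecR -norm_rnorm; near: n.
    by move/cvgrPdist_le : xl; apply; rewrite ltcR.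
  rewrite distrC (le_trans (fx _ _ fpsi psi1))// ltW//; near: n.
  exact: (near_infty_natSinv_lt (PosNum e20)).
exists l; apply/has_bochnerP; split=> // psi fpsi; split.
  exact: psi_integrable.
have [D Z [C C0 psiC]] := fpsi.
(* Dividing by the bound [C] reduces to functionals of norm at most 1. *)
have /norm1 : rfunctional (fun y => C^-1 * psi y).
  split=> [y z|r y|]; first by rewrite D mulrDr.
    by rewrite Z mulrCA.
  exists 1 => // y; rewrite mul1r normrM gtr0_norm ?invr_gt0//.
  by rewrite ler_pdivrMl.
rewrite RintegralZl//; last exact: psi_integrable.
move=> /(_ _)/(mulfI (invr_neq0 (lt0r_neq0 C0))); apply => y.
by rewrite normrM gtr0_norm ?invr_gt0// ler_pdivrMl.
Unshelve. all: by end_near. Qed.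

End radon.

(** * Algebra and continuity in a C*-algebra *)

Section cstar.
Context {R : realType} {fA : cstarAlgType R}.
Implicit Types (x y z : fA).

Lemma cmulNl x y : cmul (- x) y = - cmul x y.
Proof. by rewrite -scaleN1r cmulZl scaleN1r. Qed.

Lemma cmulNr x y : cmul x (- y) = - cmul x y.
Proof. by rewrite -scaleN1r cmulZr scaleN1r. Qed.

Lemma cmulBl x y z : cmul (x - y) z = cmul x z - cmul y z.
Proof. by rewrite cmulDl cmulNl. Qed.

Lemma cmulBr x y z : cmul z (x - y) = cmul z x - cmul z y.
Proof. by rewrite cmulDr cmulNr. Qed.

Lemma starN x : star (- x) = - star x.
Proof. by rewrite -scaleN1r starZ rmorphN rmorph1 scaleN1r. Qed.

Lemma starB x y : star (x - y) = star x - star y.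
Proof. by rewrite starD starN. Qed.

Lemma ler_rnorm_cmul x y : rnorm (cmul x y) <= rnorm x * rnorm y.
Proof. by rewrite -lecR rmorphM/= -!norm_rnorm ler_norm_cmul. Qed.

Lemma rnorm_abs2 x : rnorm (abs2 x) = rnorm x ^+ 2.
Proof.
by apply: (@complexI R); rewrite rmorphXn/= -!norm_rnorm norm_star_cmul.
Qed.

(** From $\|y\|^2 = \|y^*y\| \le \|y^*\|\,\|y\|$ one gets $\|y\| \le \|y^*\|$; apply this to [x] and
    to [star x]. *)
Lemma rnorm_star x : rnorm (star x) = rnorm x.
Proof.
have le_star y : rnorm y <= rnorm (star y).
  have [->|y0] := eqVneq (rnorm y) 0; first exact: rnorm_ge0.
  have ygt0 : 0 < rnorm y by rewrite lt_def y0 rnorm_ge0.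
  by rewrite -(ler_pM2r ygt0) -expr2 -rnorm_abs2 ler_rnorm_cmul.
by apply/le_anti; rewrite le_star andbT -{2}(starK x) le_star.
Qed.

Lemma rfunctional_cmul psi x : rfunctional psi ->
  rfunctional (fun y => psi (cmul x y)).
Proof.
move=> [D Z [C C0 psiC]]; split=> [y z|r y|]; first by rewrite cmulDr D.
  by rewrite cmulZr Z.
exists (C * (rnorm x + 1)) => [|y]; first by rewrite mulr_gt0// ltr_wpDl ?rnorm_ge0.
rewrite (le_trans (psiC _))// -mulrA ler_pM2l// (le_trans (ler_rnorm_cmul _ _))//.
by rewrite ler_wpM2r ?rnorm_ge0// lerDl.
Qed.

(** The involution is conjugate-linear, hence real-linear: composition with it preserves real
    functionals, though not complex ones. *)
Lemma rfunctional_star psi : rfunctional psi ->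
  rfunctional (fun y => psi (star y)).
Proof.
move=> [D Z [C C0 psiC]]; split=> [y z|r y|]; first by rewrite starD D.
  by rewrite starZ conj_Creal ?Z// realE !ler0c lecR; case: ltgtP.
by exists C => // y; rewrite -rnorm_star.
Qed.

Lemma rfunctional_star_cmul psi y : rfunctional psi ->
  rfunctional (fun x => psi (cmul (star x) y)).
Proof.
move=> fpsi.
have -> : (fun x => psi (cmul (star x) y)) =
    (fun x => psi (star (cmul (star y) x))).
  by apply/funext => x; rewrite starM starK.
exact: rfunctional_cmul (star y) (rfunctional_star fpsi).
Qed.

(** The squared moduli are written through real and imaginary parts, the form in which [cmeasurable]
    gives their measurability. *)
Lemma abs2B (a b : R[i]) x y : a^* * b = 1 -> b^* * a = 1 ->
  abs2 (a *: x - b *: y) =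
    (complex.Re a ^+ 2 + complex.Im a ^+ 2)%:C *: abs2 x
    + (complex.Re b ^+ 2 + complex.Im b ^+ 2)%:C *: abs2 y
    - cmul (star x) y - cmul (star y) x.
Proof.
move=> ab ba; rewrite /abs2 starB !starZ cmulBl !cmulBr !cmulZl !cmulZr !scalerA.
have sqE (c : R[i]) : c^* * c = (complex.Re c ^+ 2 + complex.Im c ^+ 2)%:C.
  by rewrite mulrC -normCK normc_def -rmorphXn/= sqr_sqrtr// addr_ge0 ?sqr_ge0.
by rewrite !sqE ab ba !scale1r opprB addrACA !addrA.
Qed.

Lemma continuous_abs2 (T : ptopologicalType) (f : T -> fA) :
  continuous f -> continuous (fun t => abs2 (f t)).
Proof.
move=> cf t; apply/cvgrPdist_le => e e0.
have eE : e = (complex.Re e)%:C by rewrite RRe_real// gtr0_real.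
have re0 : 0 < complex.Re e by rewrite -ltcR -eE.
(* [M] bounds the sum of the norms of [f t] and [f s] once [f s] is within 1 of [f t]. *)
pose M := rnorm (f t) + rnorm (f t) + 1.
have M0 : 0 < M by rewrite ltr_wpDl// addr_ge0 ?rnorm_ge0.
near=> s.
rewrite norm_rnorm eE lecR.
have d1 : rnorm (f t - f s) <= 1.
  by rewrite -lecR -norm_rnorm; near: s; move/cvgrPdist_le : (cf t); apply; rewrite ltcR.
have d2 : rnorm (f t - f s) <= complex.Re e / M.
  rewrite -lecR -norm_rnorm; near: s; move/cvgrPdist_le : (cf t); apply.
  by rewrite ltcR divr_gt0.
have -> : abs2 (f t) - abs2 (f s) =
    cmul (star (f t)) (f t - f s) + cmul (star (f t - f s)) (f s).
  by rewrite cmulBr starB cmulBl addrA subrK.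
have fs : rnorm (f s) <= rnorm (f t) + 1.
  rewrite -{1}(subKr (f t) (f s)) (le_trans (ler_rnormB _ _))// lerD2l.
  exact: d1.
rewrite (le_trans (ler_rnormD _ _))//.
rewrite (le_trans (lerD (ler_rnorm_cmul _ _) (ler_rnorm_cmul _ _)))//.
rewrite !rnorm_star [X in X + _]mulrC -mulrDr.
move: d2; rewrite ler_pdivlMr//; apply: le_trans.
by rewrite ler_wpM2l ?rnorm_ge0// /M -addrA lerD2l.
Unshelve. all: by end_near. Qed.

End cstar.

(* [g] need not be measurable: its integral is then a lower integral. *)
Lemma ge0_le_lower_integral (R : realType) (d : measure_display)
    (T : measurableType d) (mu : {measure set T -> \bar R})
    (f g : T -> \bar R) : (forall x, 0 <= f x)%E -> (forall x, f x <= g x)%E ->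
  (\int[mu]_x f x <= \int[mu]_x g x)%E.
Proof.
move=> f0 fg; have g0 x : (0 <= g x)%E := le_trans (f0 x) (fg x).
rewrite !ge0_integralTE//; apply: le_ereal_sup => _ /= [h hf <-].
by exists h => // x; exact: le_trans (hf x) (fg x).
Qed.

(** * Scalar double integrals over the product measure *)

Section double_integral.
Context {R : realType} {fA : cstarAlgType R} {T : ptopologicalType}.
Context {mu : {sigma_finite_measure set (borel T) -> \bar R}}.
Variables (U V : T -> fA) (X Y : fA).
Hypotheses (cU : continuous U) (cV : continuous V).
Hypotheses (UX : has_bochner mu U X) (VY : has_bochner mu V Y).
Variables (k : borel T * borel T -> R) (F : T -> T -> fA).
Hypothesis mk : measurable_fun setT k.
Hypothesis FE : forall t s, F t s = (k (t, s))%:C *: abs2 (U t)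
  + (k (s, t))%:C *: abs2 (V s) - cmul (star (U t)) (V s) - cmul (star (V s)) (U t).
Hypothesis F_integrable : bochner2_integrable mu F.
Variables (psi : fA -> R).
Hypothesis fpsi : rfunctional psi.

(** This is [psi (F t s)] without its mixed terms. It is built from [k] and functions of one
    variable, hence measurable for the product of the Borel sigma-algebras; this is not evident for
    the mixed terms, since that product may be smaller than the Borel sigma-algebra of the product
    space. *)
Let K (z : borel T * borel T) : R :=
  k z * psi (abs2 (U z.1)) + k (z.2, z.1) * psi (abs2 (V z.2)).

Let psiF t s : K (t, s) = psi (F t s) + psi (cmul (star (U t)) (V s))
  + psi (cmul (star (V s)) (U t)).
Proof.
rewrite FE !rfunctionalB//; have [-> Z _] := fpsi; rewrite !Z /K/=; ring.
Qed.

Let mpsi_abs2 (W : T -> fA) : continuous W ->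
  measurable_fun setT (fun t : borel T => psi (abs2 (W t))).
Proof.
move=> cW; apply: continuous_borel.
exact: (continuous_rfunctional fpsi (continuous_abs2 cW)).
Qed.

Let mK : measurable_fun setT K.
Proof.
have mswap : measurable_fun setT (fun z : borel T * borel T => (z.2, z.1)).
  by apply/measurable_fun_pairP; split; [exact: measurable_snd|exact: measurable_fst].
apply: measurable_funD; apply: measurable_funM => //.
- exact: (measurableT_comp (mpsi_abs2 cU) measurable_fst).
- exact: (measurableT_comp mk mswap).
- exact: (measurableT_comp (mpsi_abs2 cV) measurable_snd).
Qed.

(** Up to the bound of [psi], an integrable majorant of each mixed term. *)
Let G (z : borel T * borel T) : R := rnorm (U z.1) * rnorm (V z.2).

Let mrnorm (W : T -> fA) : continuous W ->
  measurable_fun setT (fun t : borel T => rnorm (W t)).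
Proof. by move=> cW; apply: continuous_borel; exact: continuous_rnorm. Qed.

Let mG : measurable_fun setT G.
Proof.
apply: measurable_funM.
- exact: (measurableT_comp (mrnorm cU) measurable_fst).
- exact: (measurableT_comp (mrnorm cV) measurable_snd).
Qed.

Let G_integrable : (mu \x mu)%E.-integrable setT (EFin \o G).
Proof.
apply/integrable21ltyP; first exact/measurable_EFinP.
have [/has_bochnerP[iU _] /has_bochnerP[iV _]] := (UX, VY).
pose c := fine (\int[mu]_t (rnorm (U t))%:E).
have cE : (\int[mu]_t (rnorm (U t))%:E = c%:E)%E.
  by rewrite fineK//; exact: (integrable_fin_num measurableT iU).
rewrite (eq_integral (fun s : borel T => (rnorm (V s))%:E * c%:E)%E).
  exact: (integrable_lty measurableT (integrableZr measurableT c iV)).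
move=> s _; rewrite -cE -integralZl//; apply: eq_integral => t _ /=.
by rewrite /G/= ger0_norm ?mulr_ge0 ?rnorm_ge0// mulrC EFinM.
Qed.

(** The norm of [F] is not known to be jointly measurable, so it is replaced by the measurable
    minorant [M]. The iterated integral of [M] is finite by comparison with that of the norm of [F],
    and [|K| <= C * (M + 2 * G)]. *)
Lemma integrable_double : (mu \x mu)%E.-integrable setT (EFin \o K).
Proof.
have [_ _ [C C0 psiC]] := fpsi.
pose M z := Num.max 0 (C^-1 * `|K z| - 2 * G z).
have mM : measurable_fun setT M.
  apply: measurable_maxr => //; apply: measurable_funB; apply: measurable_funM => //.
  exact: measurableT_comp.
have MF t s : M (t, s) <= rnorm (F t s).
  rewrite ge_max rnorm_ge0/= lerBlDr ler_pdivrMl// psiF.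
  rewrite (le_trans (ler_normD _ _))// (le_trans (lerD (ler_normD _ _) (lexx _)))//.
  rewrite mulrDr mulr_natl mulrDr addrA; apply: lerD; first apply: lerD.
  - exact: psiC.
  - rewrite (le_trans (psiC _))// ler_pM2l// (le_trans (ler_rnorm_cmul _ _))//.
    by rewrite rnorm_star.
  - rewrite (le_trans (psiC _))// ler_pM2l// (le_trans (ler_rnorm_cmul _ _))//.
    by rewrite rnorm_star mulrC.
have M_integrable : (mu \x mu)%E.-integrable setT (EFin \o M).
  apply/integrable21ltyP; first exact/measurable_EFinP.
  have [_ _] := F_integrable; apply: le_lt_trans.
  apply: ge0_le_lower_integral => s; first exact: integral_ge0.
  apply: ge0_le_lower_integral => t //=.
  by rewrite lee_fin ger0_norm ?MF// le_max lexx.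
apply: (le_integrable measurableT _ _
  (integrableZl measurableT C (integrableD measurableT M_integrable
    (integrableZl measurableT 2 G_integrable)))).
  exact/measurable_EFinP.
move=> z _ /=; rewrite lee_fin (le_trans _ (ler_norm _))//.
by rewrite -ler_pdivrMl// -lerBlDr le_max lexx orbT.
Qed.

(** By Fubini, integrate in [t] first. For fixed [s] the mixed terms are real functionals of [U t],
    so [U] integrates to [X] inside them; what results is a real functional of [V s], and [V]
    integrates to [Y]. *)
Lemma integral_double : (\int[(mu \x mu)%E]_z (K z)%:E =
  (psi (bochner2 mu F) + psi (cmul (star X) Y) + psi (cmul (star Y) X))%:E)%E.
Proof.
have [/has_bochnerP[_ UXE] /has_bochnerP[_ VYE]] := (UX, VY).
have [F1 /bochnerP/has_bochnerP[_ /(_ _ fpsi)[iF F2E]] _] := F_integrable.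
have [iXV XVE] := VYE _ (rfunctional_cmul (star X) fpsi).
have [iVX VXE] := VYE _ (rfunctional_star_cmul X fpsi).
rewrite -(integral21_prod_meas1 integrable_double).
(* The inner integral of [K], for almost every [s] only: elsewhere [bochner] may take its default
   value. *)
pose g (s : borel T) := psi (bochner mu (F^~ s)) + psi (cmul (star X) (V s))
  + psi (cmul (star (V s)) X).
have ig1 := integrableD measurableT iF iXV.
have ig := integrableD measurableT ig1 iVX.
rewrite (ae_eq_integral (fun s => (g s)%:E))//.
- rewrite /bochner2 F2E XVE VXE -(RintegralD measurableT iF iXV).
  rewrite -(RintegralD measurableT ig1 iVX) /Rintegral fineK//.
  exact: (integrable_fin_num measurableT ig).
- exact: measurable_fubini_G integrable_double.
- exact: (measurable_int _ ig).
apply: filterS F1 => s /bochnerP/has_bochnerP[_ /(_ _ fpsi)[iFs Fs]] _ /=.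
have [iUV UVE] := UXE _ (rfunctional_star_cmul (V s) fpsi).
have [iVU VUE] := UXE _ (rfunctional_cmul (star (V s)) fpsi).
have i1 := integrableD measurableT iFs iUV.
have i2 := integrableD measurableT i1 iVU.
rewrite /g Fs UVE VUE -(RintegralD measurableT iFs iUV).
rewrite -(RintegralD measurableT i1 iVU).
rewrite /Rintegral fineK; last exact: (integrable_fin_num measurableT i2).
by apply: eq_integral => t _ /=; rewrite psiF.
Qed.

End double_integral.

(** * Sigma-finiteness, symmetry, and fields that vanish almost everywhere *)

Lemma sigma_finite_measureP (R : realType) (d : measure_display)
    (T : measurableType d) (mu : {measure set T -> \bar R}) :
  sigma_finite setT mu -> exists nu : {sigma_finite_measure set T -> \bar R},
    (nu : {measure set T -> \bar R}) = mu.
Proof.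
move=> sf.
pose mu_sfinite := isSFinite.Build _ _ _ _ (sfinite_measure_sigma_finite sf).
pose mu_sigma_finite := isSigmaFinite.Build _ _ _ _ sf.
exists (HB.pack_for {sigma_finite_measure set T -> \bar R} (Measure.sort mu)
  mu_sfinite mu_sigma_finite).
exact: eq_measure.
Qed.

(** Both sides are the same iterated integral after renaming variables, taken in opposite orders for
    [f] and for its swap. *)
Lemma integral_prod_swap (R : realType) (d : measure_display)
    (T : measurableType d) (mu : {sigma_finite_measure set T -> \bar R})
    (f : T * T -> \bar R) :
  (mu \x mu)%E.-integrable setT f ->
  (mu \x mu)%E.-integrable setT (fun z => f (z.2, z.1)) ->
  (\int[(mu \x mu)%E]_z f (z.2, z.1) = \int[(mu \x mu)%E]_z f z)%E.
Proof.
by move=> fi fsi; rewrite -(integral21_prod_meas1 fsi) -(integral12_prod_meas1 fi).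
Qed.

Lemma integrable_gt0_sigma_finite (R : realType) (d : measure_display)
    (T : measurableType d) (mu : {measure set T -> \bar R}) (g : T -> R) :
  mu.-integrable setT (fun t => (g t)%:E) -> (forall t, 0 < g t) ->
  sigma_finite setT mu.
Proof.
move=> gi g0.
exists (fun n => setT `&` [set t | (n.+1%:R^-1)%:E <= `|(g t)%:E|]%E).
  apply/seteqP; split=> // t _; near \oo => n; exists n => //; split=> //=.
  rewrite lee_fin ger0_norm ?(ltW (g0 t))// ltW//; near: n.
  exact: (near_infty_natSinv_lt (PosNum (g0 t))).
by move=> n; apply: integrable_superlevel_lty gi _; rewrite invr_gt0.
Unshelve. all: by end_near. Qed.

Section bochner_cstar.
Context {R : realType} {fA : cstarAlgType R} {T : ptopologicalType}.
Context {mu : {measure set (borel T) -> \bar R}}.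

Lemma has_bochnerB (f g : T -> fA) x y : continuous f -> continuous g ->
  has_bochner mu f x -> has_bochner mu g y ->
  has_bochner mu (fun t => f t - g t) (x - y).
Proof.
move=> cf cg /has_bochnerP[fi fx] /has_bochnerP[gi gy]; apply/has_bochnerP; split.
  apply: (le_integrable measurableT _ _ (integrableD measurableT fi gi)).
    apply/measurable_EFinP; apply: continuous_borel; apply: continuous_rnorm.
    by move=> t; apply: cvgB; [exact: cf|exact: cg].
  move=> t _; rewrite lee_fin !ger0_norm ?addr_ge0 ?rnorm_ge0//.
  exact: ler_rnormB.
move=> psi fpsi; have [[ifx fE] [igy gE]] := (fx _ fpsi, gy _ fpsi).
have psiB : (fun t => psi (f t - g t)) = (fun t => psi (f t) - psi (g t)).
  by apply/funext => t; rewrite rfunctionalB.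
split; last by rewrite rfunctionalB// psiB fE gE -RintegralB.
rewrite (_ : (fun t => _) = (fun t => (psi (f t) - psi (g t))%:E)).
  exact: (integrableB measurableT ifx igy).
by apply/funext => t; rewrite rfunctionalB.
Qed.

(** Whenever [V s = 0], the inner integrand vanishes for almost every [t]; so the inner integral is
    0 for almost every [s]. *)
Lemma bochner2_ae0 (U V : T -> fA) (F : T -> T -> fA) :
  (forall t s, U t = 0 -> V s = 0 -> F t s = 0) ->
  {ae mu, forall t, U t = 0} -> {ae mu, forall t, V t = 0} ->
  bochner2_integrable mu F -> bochner2 mu F = 0.
Proof.
move=> F0 U0 V0 [Fi /bochnerP Fb _].
apply: (has_bochner_ae0 _ Fb).
have aeF := ae_filter_ringOfSetsType mu.
apply: filterS2 V0 Fi => s Vs /bochnerP; apply: has_bochner_ae0.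
by apply: filterS U0 => t Ut; exact: F0.
Qed.

(* For [W s <> 0], the function [|W t| + |F t s|] of [t] is integrable and
   vanishes nowhere. *)
Lemma sigma_finite_or_ae0 (W : T -> fA) (alpha : T * T -> R[i]) :
  (forall t s, alpha (t, s) != 0) -> norm_integrable mu W ->
  bochner2_integrable mu
    (fun t s => abs2 (alpha (t, s) *: W t - alpha (s, t) *: W s)) ->
  sigma_finite setT mu \/ {ae mu, forall t, W t = 0}.
Proof.
move=> alpha0 Wi [Fi _ _].
have [|nsf] := pselect (sigma_finite setT mu); first by left.
have aeF := ae_filter_ringOfSetsType mu.
right; apply: filterS Fi => s [x [Fsi _]]; apply: contra_notP nsf => /eqP Ws.
apply: (integrable_gt0_sigma_finite (integrableD measurableT Wi Fsi)) => t /=.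
(* Where [W t = 0], the second summand is the squared norm of [alpha (s, t) *: W s], which is
   nonzero. *)
have [->|Wt] := eqVneq (W t) 0.
  rewrite rnorm0 add0r scaler0 sub0r rnorm_abs2 rnormN exprn_gt0//.
  by rewrite lt_def rnorm_ge0 rnorm_eq0 scaler_eq0 negb_or alpha0 Ws.
by rewrite ltr_pwDl ?rnorm_ge0// lt_def rnorm_ge0 rnorm_eq0 Wt.
Qed.

End bochner_cstar.

(** * The identity for sigma-finite measures, then in general *)

Lemma double_integral_identity (R : realType) (fA : cstarAlgType R)
    (T : ptopologicalType) (mu : {sigma_finite_measure set (borel T) -> \bar R})
    (A B : T -> fA) (X Y : fA) (alpha : T * T -> R[i]) :
  continuous A -> continuous B -> has_bochner mu A X -> has_bochner mu B Y ->
  cmeasurable (alpha : (borel T * borel T)%type -> R[i]) ->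
  (forall t s : T, (alpha (t, s))^* * alpha (s, t) = 1) ->
  bochner2_integrable mu
    (fun t s => abs2 (alpha (t, s) *: A t - alpha (s, t) *: A s)) ->
  bochner2_integrable mu
    (fun t s => abs2 (alpha (t, s) *: B t - alpha (s, t) *: B s)) ->
  bochner2_integrable mu
    (fun t s => abs2 (alpha (t, s) *: A t - alpha (s, t) *: B s)) ->
  bochner2 mu (fun t s => abs2 (alpha (t, s) *: A t - alpha (s, t) *: A s))
  + bochner2 mu (fun t s => abs2 (alpha (t, s) *: B t - alpha (s, t) *: B s))
  = bochner2 mu (fun t s => abs2 (alpha (t, s) *: A t - alpha (s, t) *: B s))
      *+ 2 - abs2 (X - Y) *+ 2.
Proof.
move=> cA cB AX BY [mRe mIm] alphaK iAA iBB iAB.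
pose k (z : borel T * borel T) :=
  complex.Re (alpha z) ^+ 2 + complex.Im (alpha z) ^+ 2.
have mk : measurable_fun setT k.
  by apply: measurable_funD; exact: measurable_funX.
have FE (U V : T -> fA) t s : abs2 (alpha (t, s) *: U t - alpha (s, t) *: V s) =
    (k (t, s))%:C *: abs2 (U t) + (k (s, t))%:C *: abs2 (V s)
    - cmul (star (U t)) (V s) - cmul (star (V s)) (U t).
  exact: abs2B.
apply: rfunctional_separate => psi fpsi; have [D _ _] := fpsi.
pose K (U V : T -> fA) (z : borel T * borel T) : R :=
  k z * psi (abs2 (U z.1)) + k (z.2, z.1) * psi (abs2 (V z.2)).
have EAA : (\int[(mu \x mu)%E]_z (K A A z)%:E = _)%E :=
  integral_double cA cA AX AX mk (FE A A) iAA fpsi.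
have EBB : (\int[(mu \x mu)%E]_z (K B B z)%:E = _)%E :=
  integral_double cB cB BY BY mk (FE B B) iBB fpsi.
have EAB : (\int[(mu \x mu)%E]_z (K A B z)%:E = _)%E :=
  integral_double cA cB AX BY mk (FE A B) iAB fpsi.
have KAA : (mu \x mu)%E.-integrable setT (fun z => (K A A z)%:E) :=
  integrable_double cA cA AX AX mk (FE A A) iAA fpsi.
have KBB : (mu \x mu)%E.-integrable setT (fun z => (K B B z)%:E) :=
  integrable_double cB cB BY BY mk (FE B B) iBB fpsi.
have KAB : (mu \x mu)%E.-integrable setT (fun z => (K A B z)%:E) :=
  integrable_double cA cB AX BY mk (FE A B) iAB fpsi.
have KE z : K A A z + K B B z = K A B z + K A B (z.2, z.1).
  by case: z => t s; rewrite /K/=; ring.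
(* By [KE], the swapped kernel is a combination of the three integrable ones. *)
have KBA : (mu \x mu)%E.-integrable setT (fun z => (K A B (z.2, z.1))%:E).
  have KAABB := integrableD measurableT KAA KBB.
  apply: eq_integrable (integrableB measurableT KAABB KAB) => //.
  by move=> z _ /=; rewrite -!EFinD KE addrAC subrr add0r.
have : (\int[(mu \x mu)%E]_z (K A A z)%:E + \int[(mu \x mu)%E]_z (K B B z)%:E =
    \int[(mu \x mu)%E]_z (K A B z)%:E + \int[(mu \x mu)%E]_z (K A B z)%:E)%E.
  rewrite -[X in (_ = _ + X)%E](integral_prod_swap KAB KBA).
  rewrite -!integralD//; apply: eq_integral => z _.
  by rewrite -!EFinD KE.
rewrite EAA EBB EAB -!EFinD => -[].
move: (bochner2 mu _) (bochner2 mu _) (bochner2 mu _) => a b c.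
(* The integrals gave $\psi(a + 2X^*X + b + 2Y^*Y) = 2\psi(c + X^*Y + Y^*X)$; expanding $|X-Y|^2$
   yields the claim. *)
rewrite !mulr2n rfunctionalB// !D /abs2 starB cmulBl !cmulBr !rfunctionalB//.
lra.
Qed.

Theorem theorem2p2 (R : realType) (fA : cstarAlgType R) (T : ptopologicalType)
    (mu : {measure set (borel T) -> \bar R}) (A B : T -> fA)
    (alpha : T * T -> R[i])
    (T_hausdorff : hausdorff_space T)
    (T_locally_compact : locally_compact [set: T])
    (mu_radon : radon mu)
    (A_continuous : continuous A) (B_continuous : continuous B)
    (A_integrable : norm_integrable mu A)
    (B_integrable : norm_integrable mu B)
    (alpha_measurable :
      cmeasurable (alpha : (borel T * borel T)%type -> R[i]))
    (alpha_conj : forall t s : T, (alpha (t, s))^* * alpha (s, t) = 1)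
    (* the double integrals in the identity exist *)
    (AA_integrable : bochner2_integrable mu
      (fun t s => abs2 (alpha (t, s) *: A t - alpha (s, t) *: A s)))
    (BB_integrable : bochner2_integrable mu
      (fun t s => abs2 (alpha (t, s) *: B t - alpha (s, t) *: B s)))
    (AB_integrable : bochner2_integrable mu
      (fun t s => abs2 (alpha (t, s) *: A t - alpha (s, t) *: B s))) :
  bochner2 mu (fun t s => abs2 (alpha (t, s) *: A t - alpha (s, t) *: A s))
  + bochner2 mu (fun t s => abs2 (alpha (t, s) *: B t - alpha (s, t) *: B s))
  = bochner2 mu (fun t s => abs2 (alpha (t, s) *: A t - alpha (s, t) *: B s))
      *+ 2
    - abs2 (bochner mu (fun t => A t - B t)) *+ 2.
Proof.
have [X AX] := continuous_bochner_integrable T_hausdorff mu_radon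
  A_continuous A_integrable.
have [Y BY] := continuous_bochner_integrable T_hausdorff mu_radon
  B_continuous B_integrable.
rewrite (bochnerE (has_bochnerB A_continuous B_continuous AX BY)).
have alpha0 t s : alpha (t, s) != 0.
  by apply/eqP => ats; have /eqP := alpha_conj s t; rewrite ats mulr0 eq_sym oner_eq0.
have [sf|[A0 B0]] : sigma_finite setT mu \/
    ({ae mu, forall t, A t = 0} /\ {ae mu, forall t, B t = 0}).
  have [?|A0] := sigma_finite_or_ae0 alpha0 A_integrable AA_integrable; first by left.
  have [?|B0] := sigma_finite_or_ae0 alpha0 B_integrable BB_integrable; first by left.
  by right.
(* Replacing [mu] by its sigma-finite packaging makes the product measure results available. *)
- have [nu numu] := sigma_finite_measureP sf; subst mu.
  exact: double_integral_identity.
- have F0 (U V : T -> fA) t s : U t = 0 -> V s = 0 ->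
      abs2 (alpha (t, s) *: U t - alpha (s, t) *: V s) = 0.
    move=> -> ->; apply/eqP.
    by rewrite !scaler0 subrr -rnorm_eq0 rnorm_abs2 rnorm0 expr0n.
  rewrite !(bochner2_ae0 (F0 _ _))// (has_bochner_ae0 A0 AX) (has_bochner_ae0 B0 BY).
  have -> : abs2 (0 - 0 : fA) = 0.
    by apply/eqP; rewrite subrr -rnorm_eq0 rnorm_abs2 rnorm0 expr0n.
  by rewrite !mul0rn addr0 subr0.
Qed.
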